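(* Let $\Sigma=(X,Y,f,h,x_0)$ be a rational system (respectively, a polynomial system) without inputs, with $X=\mathbb{R}^n$ and $Y=\mathbb{R}^{m_y}$. If $\Sigma$ is finitely algebraically observable, then there exists an output-based realization of $\Sigma$ which is rational (respectively, polynomial). Thus the system $\Sigma_{or}=(X_{or},Y,f_{or},h_{or},x_{or,0})$ given by $$\frac{d\hat x(t)}{dt}=f_{or}(\hat x(t)),\quad \hat x(0)=x_{or,0}=s(x_0),\qquad y(t)=h_{or}(\hat x(t)),$$ $$f_{or}(\hat x)=\Big(\frac{\partial s(x)}{\partial x}f(x)\Big)\Big|_{x=s^{-1}(\hat x)},\qquad h_{or}(\hat x)=C_o\hat x,\qquad C_o=\begin{pmatrix}I_{m_y}&0&\cdots&0\end{pmatrix},$$ with $X_{or}=\mathbb{R}^{n_o}$, where $s:\mathbb{R}^n\to\mathbb{R}^{n_o}$ is the state-space transformation of $\Sigma$ and $s^{-1}$ its rational (respectively, polynomial) inverse, is a rational system (respectively, a polynomial system).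
   Context: A rational system without inputs $\Sigma=(X,Y,f,h,x_0)$ is a system $\frac{dx(t)}{dt}=f(x(t))$, $x(0)=x_0\in X$, $y(t)=h(x(t))$, where the state space $X$ is an irreducible real algebraic variety in some $\mathbb{R}^n$ (here $X=\mathbb{R}^n$), $Y=\mathbb{R}^{m_y}$ with $m_y$ a positive integer, and the components of $f:X\to\mathbb{R}^n$ and $h:X\to\mathbb{R}^{m_y}$ are rational functions on $X$ that are defined at the initial state $x_0$. A polynomial system is defined in the same way with the components of $f$ and $h$ polynomials. Write $\mathbb{R}[x]=\mathbb{R}[x_1,\dots,x_n]$ and $\mathbb{R}(x)=\mathbb{R}(x_1,\dots,x_n)$. Define functions $s_k$ with values in $\mathbb{R}^{m_y}$ by $s_1=h$ and $s_{k+1}(x)=\frac{\partial s_k(x)}{\partial x}f(x)$ for $k\ge1$; thus along solutions $s_k(x(t))=\frac{d^{k-1}y(t)}{dt^{k-1}}$. List the scalar components of $s_1,s_2,\dots$, block by block, as one sequence $\sigma_1,\sigma_2,\dots$. For $m\ge1$, the $m$-th observation algebra is $A_{obs,m}(\Sigma)=\mathbb{R}[\sigma_1,\dots,\sigma_m]$ (the $\mathbb{R}$-algebra generated by these functions), and the $m$-th observation field $Q_{obs,m}(\Sigma)$ is its field of fractions. A rational system is finitely algebraically observable if $Q_{obs,m}(\Sigma)=\mathbb{R}(x)$ for some integer $m\ge1$; a polynomial system is finitely algebraically observable if $A_{obs,m}(\Sigma)=\mathbb{R}[x]$ for some integer $m\ge1$. The rational (respectively, polynomial) observability index $m_o$,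 counted in blocks of $m_y$ functions, is the least positive integer such that the components of $s_1,\dots,s_{m_o}$ generate $\mathbb{R}(x)$ as a field over $\mathbb{R}$ (respectively, $\mathbb{R}[x]$ as an $\mathbb{R}$-algebra); put $n_o=m_om_y$. The state-space transformation is $s=(s_1,\dots,s_{m_o}):\mathbb{R}^n\to\mathbb{R}^{n_o}$. A rational (respectively, polynomial) inverse of $s$ is a map $s^{-1}$ whose components are rational functions (respectively, polynomials) in $n_o$ variables with $s^{-1}(s(x))=x$ (in the rational case, as an identity of rational functions in $\mathbb{R}(x)$). For a finitely algebraically observable system such an inverse exists, and $s^{-1}$ denotes the inverse so constructed. A realization is output-based if its state is a function of the output and of the output's derivatives; here the state is $\hat x(t)=s(x(t))=\big(y(t),\frac{dy(t)}{dt},\dots,\frac{d^{m_o-1}y(t)}{dt^{m_o-1}}\big)^T$.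
   Formalization: In the rational case, that Σ_or is a rational system is proved when s^{-1} is defined at s(x_0) (it fails for x'=1, y=x³, x_0=0), and it realizes Σ on some [0,T'); in general the differential equation is proved at the times where f_or is defined at s(x(t)). *)

(* Defs.v *)
From HB Require Import structures.
(* mpoly must be imported before the analysis files: in the other order their
   notations clash. *)
From mathcomp Require Import all_boot all_order all_algebra.
From mathcomp Require Import generic_quotient fraction mpoly.
From mathcomp Require Import boolp classical_sets reals topology normedtype.
From mathcomp Require Import derive.

Set Implicit Arguments.
Unset Strict Implicit.
Unset Printing Implicit Defensive.

Import Order.TTheory GRing.Theory Num.Theory.
Import numFieldNormedType.Exports.

Local Open Scope classical_set_scope.
Local Open Scope ring_scope.

Local Notation "x %:F" := (tofrac x) : ring_scope.

Definition ratfun (R : realType) (n : nat) : fieldType :=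
  {fraction {mpoly R[n]}}.

Definition ratC (R : realType) (n : nat) : R -> ratfun R n :=
  fun c => (c%:MP_[n])%:F.

Definition ratX (R : realType) (n : nat) (i : 'I_n) : ratfun R n :=
  ('X_i : {mpoly R[n]})%:F.

Definition is_poly (R : realType) (n : nat) (g : ratfun R n) : Prop :=
  exists p : {mpoly R[n]}, g = p%:F.

(* [repr] picks some representation p / q of g; the quotient rule gives the
   same element of the field of fractions for all of them. *)
Definition ratderiv (R : realType) (n : nat) (j : 'I_n) (g : ratfun R n) :
    ratfun R n :=
  let p := \n_(repr g) in let q := \d_(repr g) in
  (p^`M(j) * q - p * q^`M(j))%:F / (q ^+ 2)%:F.

Definition ratjac (R : realType) (m n : nat) (g : 'cV[ratfun R n]_m) :
    'M[ratfun R n]_(m, n) :=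
  \matrix_(i, j) ratderiv j (g i 0).

(* Substituting the point a of K^n in the rational function g, where phi embeds
   R in K. With K = R this is the value of g at a real point; with
   K = ratfun R m and a tuple of rational functions a it is the composite of g
   with a. A rational function is defined at a as soon as one of its
   representations p / q has a denominator not vanishing at a, and the value
   does not depend on that representation. *)
Definition is_ratsubst (R : realType) (n : nat) (K : fieldType) (phi : R -> K)
    (a : 'cV[K]_n) (g : ratfun R n) (v : K) : Prop :=
  exists p q : {mpoly R[n]},
    [/\ mmap phi (fun i => a i 0) q != 0, g = p%:F / q%:F
      & v = mmap phi (fun i => a i 0) p / mmap phi (fun i => a i 0) q].

Definition ratsubst_defined (R : realType) (n : nat) (K : fieldType)
    (phi : R -> K) (a : 'cV[K]_n) (g : ratfun R n) : Prop :=
  exists v : K, is_ratsubst phi a g v.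

Definition ratsubst (R : realType) (n : nat) (K : fieldType) (phi : R -> K)
    (a : 'cV[K]_n) (g : ratfun R n) : K :=
  xget 0 [set v | is_ratsubst phi a g v].

Definition defined_at (R : realType) (m n : nat) (g : 'cV[ratfun R n]_m)
    (a : 'cV[R]_n) : Prop :=
  forall i, ratsubst_defined (fun c : R => c) a (g i 0).

Definition rateval (R : realType) (m n : nat) (g : 'cV[ratfun R n]_m)
    (a : 'cV[R]_n) : 'cV[R]_m :=
  \col_i ratsubst (fun c : R => c) a (g i 0).

Definition ratcomposable (R : realType) (m n k : nat) (g : 'cV[ratfun R n]_m)
    (r : 'cV[ratfun R k]_n) : Prop :=
  forall i, ratsubst_defined (@ratC R k) r (g i 0).

Definition ratcomp (R : realType) (m n k : nat) (g : 'cV[ratfun R n]_m)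
    (r : 'cV[ratfun R k]_n) : 'cV[ratfun R k]_m :=
  \col_i ratsubst (@ratC R k) r (g i 0).

Definition is_polymap (R : realType) (m n : nat) (g : 'cV[ratfun R n]_m) :
    Prop :=
  forall i, is_poly (g i 0).

(* A system without inputs with state space R^n and output space R^my. *)
Record system (R : realType) (n my : nat) := System {
  sys_f : 'cV[ratfun R n]_n ;
  sys_h : 'cV[ratfun R n]_my ;
  sys_x0 : 'cV[R]_n }.

Definition system_defined_at (R : realType) (n my : nat) (S : system R n my)
    (a : 'cV[R]_n) : Prop :=
  defined_at (sys_f S) a /\ defined_at (sys_h S) a.

Definition rational_system (R : realType) (n my : nat) (S : system R n my) :
    Prop :=
  system_defined_at S (sys_x0 S).

Definition polynomial_system (R : realType) (n my : nat) (S : system R n my) :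
    Prop :=
  is_polymap (sys_f S) /\ is_polymap (sys_h S).

(* The sequence is indexed from 0: [sfun S k] is s_(k+1). *)
Fixpoint sfun (R : realType) (n my : nat) (S : system R n my) (k : nat) :
    'cV[ratfun R n]_my :=
  if k is k'.+1 then ratjac (sfun S k') *m sys_f S else sys_h S.

(* The scalar components of s_1, s_2, ..., block by block and indexed from 0.
   The default value is reached only when my = 0. *)
Definition sigma (R : realType) (n my : nat) (S : system R n my) (k : nat) :
    ratfun R n :=
  if insub (k %% my)%N is Some j then sfun S (k %/ my)%N j 0 else 0.

Definition Aobs (R : realType) (n my : nat) (S : system R n my) (m : nat) :
    set (ratfun R n) :=
  [set g | exists P : {mpoly R[m]},
     g = mmap (@ratC R n) (fun i : 'I_m => sigma S i) P].

Definition Qobs (R : realType) (n my : nat) (S : system R n my) (m : nat) :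
    set (ratfun R n) :=
  [set g | exists a b, [/\ Aobs S m a, Aobs S m b, b != 0 & g = a / b]].

Definition rat_generated (R : realType) (n my : nat) (S : system R n my)
    (m : nat) : Prop :=
  Qobs S m = setT.

Definition poly_generated (R : realType) (n my : nat) (S : system R n my)
    (m : nat) : Prop :=
  Aobs S m = [set g | is_poly g].

Definition rat_observable (R : realType) (n my : nat) (S : system R n my) :
    Prop :=
  exists m, (0 < m)%N /\ rat_generated S m.

Definition poly_observable (R : realType) (n my : nat) (S : system R n my) :
    Prop :=
  exists m, (0 < m)%N /\ poly_generated S m.

Definition least_positive (P : nat -> Prop) (m : nat) : Prop :=
  [/\ (0 < m)%N, P m & forall k, (0 < k)%N -> P k -> (m <= k)%N].

Definition rat_obs_index (R : realType) (n my : nat) (S : system R n my) :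
    nat -> Prop :=
  least_positive (fun m => rat_generated S (m * my)).

Definition poly_obs_index (R : realType) (n my : nat) (S : system R n my) :
    nat -> Prop :=
  least_positive (fun m => poly_generated S (m * my)).

Definition state_map (R : realType) (n my : nat) (S : system R n my)
    (mo : nat) : 'cV[ratfun R n]_(mo * my) :=
  \col_(i < mo * my) sigma S i.

Definition rat_inverse (R : realType) (n k : nat) (s : 'cV[ratfun R n]_k)
    (sinv : 'cV[ratfun R k]_n) : Prop :=
  forall i, is_ratsubst (@ratC R n) s (sinv i 0) (ratX R i).

Definition poly_inverse (R : realType) (n k : nat) (s : 'cV[ratfun R n]_k)
    (sinv : 'cV[ratfun R k]_n) : Prop :=
  is_polymap sinv /\ rat_inverse s sinv.

Definition Co (R : realType) (mo my : nat) : 'M[R]_(my, mo * my) :=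
  \matrix_(i, j) (i == j :> nat)%:R.

Definition linmap (R : realType) (m k : nat) (A : 'M[R]_(m, k)) :
    'cV[ratfun R k]_m :=
  map_mx (@ratC R k) A *m \col_i ratX R i.

Definition sys_or (R : realType) (n my : nat) (S : system R n my) (mo : nat)
    (sinv : 'cV[ratfun R (mo * my)]_n) : system R (mo * my) my :=
  System (ratcomp (ratjac (state_map S mo) *m sys_f S) sinv)
         (linmap (Co R mo my))
         (rateval (state_map S mo) (sys_x0 S)).

Definition ode_at (R : realType) (n my : nat) (S : system R n my)
    (x : R -> 'cV[R]_n) (t : R) : Prop :=
  forall i, is_derive t 1 (fun u => x u i 0) (rateval (sys_f S) (x t) i 0).

(* The one-sided equation at t = 0 follows from the equation on the open
   interval and continuity at 0. *)
Definition solution (R : realType) (n my : nat) (S : system R n my) (T : R)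
    (x : R -> 'cV[R]_n) : Prop :=
  [/\ x 0 = sys_x0 S,
      forall i, {within `[0, T[, continuous (fun u => x u i 0)},
      forall t, t \in `[0, T[ -> system_defined_at S (x t)
    & forall t, t \in `]0, T[ -> ode_at S x t].

Definition output (R : realType) (n my : nat) (S : system R n my)
    (x : R -> 'cV[R]_n) (t : R) : 'cV[R]_my :=
  rateval (sys_h S) (x t).

(* v = (y(t), y'(t), ..., y^(mo-1)(t)), all these derivatives existing. *)
Definition is_jet (R : realType) (mo my : nat) (y : R -> 'cV[R]_my) (t : R)
    (v : 'cV[R]_(mo * my)) : Prop :=
  forall (i : 'I_(mo * my)) (k : nat) (j : 'I_my), i = (k * my + j)%N :> nat ->
    v i 0 = derive1n k (fun u => y u j 0) t /\
    forall l, (l < k)%N -> derivable (derive1n l (fun u => y u j 0)) t 1.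

(* The ODE of S' is asserted only at the times t at which the rational right-hand
   side of S' is defined at s(x(t)); everything else holds throughout. *)
Definition realizes_where_defined (R : realType) (n my mo : nat)
    (S : system R n my) (S' : system R (mo * my) my)
    (s : 'cV[ratfun R n]_(mo * my)) (T : R) (x : R -> 'cV[R]_n) : Prop :=
  let xh := fun t => rateval s (x t) in
  [/\ xh 0 = sys_x0 S',
      forall i, {within `[0, T[, continuous (fun u => xh u i 0)},
      forall t, t \in `]0, T[ -> system_defined_at S' (xh t) -> ode_at S' xh t,
      forall t, t \in `[0, T[ -> output S' xh t = output S x t
    & forall t, t \in `]0, T[ -> is_jet (output S x) t (xh t)].

Definition realizes_on (R : realType) (n my mo : nat)
    (S : system R n my) (S' : system R (mo * my) my)
    (s : 'cV[ratfun R n]_(mo * my)) (T : R) (x : R -> 'cV[R]_n) : Prop :=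
  let xh := fun t => rateval s (x t) in
  [/\ solution S' T xh,
      forall t, t \in `[0, T[ -> output S' xh t = output S x t
    & forall t, t \in `]0, T[ -> is_jet (output S x) t (xh t)].

(* Main.v *)
Require Import Defs.
From HB Require Import structures.
From mathcomp Require Import all_boot all_order all_algebra.
From mathcomp Require Import generic_quotient fraction mpoly.
From mathcomp Require Import boolp classical_sets reals topology normedtype.
From mathcomp Require Import derive realfun.
From mathcomp Require Import ring.

Set Implicit Arguments.
Unset Strict Implicit.
Unset Printing Implicit Defensive.

Import Order.TTheory GRing.Theory Num.Theory.
Import numFieldNormedType.Exports.
Local Open Scope classical_set_scope.
Local Open Scope ring_scope.

(** Everything rests on one property of the substitution g(r(a)). If each r_i
    takes the value b_i at a, and g is defined at b with value v, then g(r)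
    makes sense and takes the value v at a: a denominator q of g with
    q(b) <> 0 cannot vanish identically on r, since q(r) takes at a the value
    q(b). With a = s in R(x)^n_o, r = s^-1 and b = x, it shows that every
    rational function g can be composed with s^-1, the composite returning to g
    on substitution of s; so f_or exists. With a real point a, r = s and
    b = s(a), it shows that f_or(s(a)) is the Lie derivative of s along f at a
    wherever f_or is defined at s(a), which gives the differential equation of
    the realization by the chain rule. *)

Local Notation "x %:F" := (tofrac x) : ring_scope.

(** * Fractions as quotients, and induction on polynomials *)

(** The quotient construction of the field of fractions is opened only here; later arguments compute
    with field operations. *)
Lemma frac_numden (D : idomainType) (g : {fraction D}) :
  g = (\n_(repr g))%:F / (\d_(repr g))%:F.
Proof.
have dn0 : (\d_(repr g))%:F != 0 :> {fraction D}.
  by rewrite tofrac_eq0 denom_ratioP.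
apply/(canRL (mulfK dn0)); rewrite -{1}[g]reprK; unlock tofrac.
rewrite -[LHS]FracField.pi_mul /FracField.mulf !numden_Ratio ?oner_eq0 //.
apply/eqmodP; rewrite /= FracField.equivfE.
by rewrite !numden_Ratio ?mulr1 ?oner_eq0 ?denom_ratioP // mulrC.
Qed.

(** Constants and variables generate the polynomials as an algebra. This form of induction suits
    properties compatible with sums and products, such as those of [mmap] and [meval]. *)
Lemma mpoly_alg_ind (n : nat) (R : comNzRingType) (P : {mpoly R[n]} -> Prop) :
    (forall c, P c%:MP) -> (forall i, P 'X_i) ->
    (forall p q, P p -> P q -> P (p + q)) ->
    (forall p q, P p -> P q -> P (p * q)) ->
  forall p, P p.
Proof.
move=> PC PX PD PM; elim/mpolyind => [|c m p _ _ Pp]; first by rewrite -mpolyC0.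
apply: (PD) => //; rewrite -mul_mpolyC; apply: (PM) => //.
rewrite mpolyXE_id; apply: big_ind => //; first by rewrite -mpolyC1.
move=> i _; elim: (m i) => [|k Pk]; first by rewrite expr0 -mpolyC1.
by rewrite exprS; apply: PM.
Qed.

(** With this structure [ratC] can serve as the embedding [phi], and [mmap] along it is a ring
    morphism. *)
HB.instance Definition _ (R : realType) (n : nat) :=
  GRing.RMorphism.copy (@ratC R n) (@tofrac _ \o @mpolyC n R).

(** * Partial derivatives of rational functions *)

Section Ratderiv.
Variables (R : realType) (n : nat).
Implicit Types (p q : {mpoly R[n]}) (g : ratfun R n).

(** Independence of the representation: it follows from P q = p Q together with the derivative of
    this equation. *)
Lemma ratderiv_frac (j : 'I_n) p q : q != 0 ->
  ratderiv j (p%:F / q%:F) = (p^`M(j) * q - p * q^`M(j))%:F / (q ^+ 2)%:F.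
Proof.
move=> q0; rewrite /ratderiv.
set g := p%:F / q%:F; set P := \n_(repr g); set Q := \d_(repr g).
have Q0 : Q != 0 by apply: denom_ratioP.
have /eqP : P%:F / Q%:F = p%:F / q%:F by rewrite -frac_numden.
rewrite eqr_div ?tofrac_eq0 // -!tofracM tofrac_eq => /eqP e.
have := congr1 (mderiv j) e; rewrite !mderivM => e'.
apply/eqP; rewrite eqr_div ?tofrac_eq0 ?expf_neq0 // -!tofracM tofrac_eq.
rewrite -subr_eq0; apply/eqP.
set A := mderiv j P in e' *; set B := mderiv j Q in e' *.
set c := mderiv j p in e' *; set d := mderiv j q in e' *.
(* The first bracket vanishes by [e'], the second by [e]; the coefficient of the latter is the
   derivative of Q q. *)
transitivity (Q * q * ((A * q + P * d) - (c * Q + p * B))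
              - (B * q + Q * d) * (P * q - p * Q)); first by ring.
by rewrite e e' !subrr !mulr0 subrr.
Qed.

Lemma ratderiv_tofrac (j : 'I_n) p : ratderiv j p%:F = (p^`M(j))%:F.
Proof.
rewrite -[p%:F]divr1 -tofrac1 ratderiv_frac ?oner_neq0 //.
by rewrite expr1n tofrac1 divr1 mulr1 -mpolyC1 mderivC mulr0 subr0.
Qed.

End Ratderiv.

(** * Polynomials inside the field of rational functions *)

Section Polynomials.
Variables (R : realType) (n : nat).

Lemma is_polyC c : is_poly (@ratC R n c). Proof. by exists c%:MP. Qed.

Lemma is_polyD (g h : ratfun R n) : is_poly g -> is_poly h -> is_poly (g + h).
Proof. by move=> [p ->] [q ->]; exists (p + q); rewrite tofracD. Qed.

Lemma is_polyM (g h : ratfun R n) : is_poly g -> is_poly h -> is_poly (g * h).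
Proof. by move=> [p ->] [q ->]; exists (p * q); rewrite tofracM. Qed.

Lemma is_poly_sum (I : finType) (g : I -> ratfun R n) :
  (forall i, is_poly (g i)) -> is_poly (\sum_i g i).
Proof.
move=> gp; apply: big_ind => //; last exact: is_polyD.
by exists 0; rewrite tofrac0.
Qed.

Lemma is_poly_deriv (j : 'I_n) (g : ratfun R n) :
  is_poly g -> is_poly (ratderiv j g).
Proof. by move=> [p ->]; exists p^`M(j); rewrite ratderiv_tofrac. Qed.

Lemma is_poly_mmap (k : nat) (r : 'I_k -> ratfun R n) (p : {mpoly R[k]}) :
  (forall i, is_poly (r i)) -> is_poly (mmap (@ratC R n) r p).
Proof.
move=> rp; elim/mpoly_alg_ind: p => [c|i|p q IHp IHq|p q IHp IHq].
- by rewrite mmapC; exact: is_polyC.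
- by rewrite mmapX mmap1U.
- by rewrite rmorphD; exact: is_polyD.
- by rewrite rmorphM; exact: is_polyM.
Qed.

Lemma mmap_ratX (p : {mpoly R[n]}) :
  mmap (@ratC R n) (fun i => ratX R i) p = p%:F.
Proof.
elim/mpoly_alg_ind: p => [c|i|p q IHp IHq|p q IHp IHq].
- by rewrite mmapC.
- by rewrite mmapX mmap1U.
- by rewrite !rmorphD /= IHp IHq.
- by rewrite !rmorphM /= IHp IHq.
Qed.

End Polynomials.

(** * Substitution into rational functions *)

Section Ratsubst.
Variables (R : realType) (K : fieldType) (phi : {rmorphism R -> K}).
Variables (n : nat) (a : 'cV[K]_n).
Implicit Types (g h : ratfun R n) (v w : K).
Local Notation ev := (mmap phi (fun i => a i 0)).

Lemma ratsubst_denom_neq0 (q : {mpoly R[n]}) : ev q != 0 -> q != 0.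
Proof. by apply: contraNneq => ->; rewrite rmorph0. Qed.

(** Evaluation is a morphism, so it transports p q' = p' q, and both denominators stay nonzero after
    it. *)
Lemma is_ratsubst_unique g v w :
  is_ratsubst phi a g v -> is_ratsubst phi a g w -> v = w.
Proof.
move=> [p [q [q0 -> ->]]] [p' [q' [q'0 /eqP e ->]]].
move: e; rewrite eqr_div ?tofrac_eq0 ?ratsubst_denom_neq0 //.
rewrite -!tofracM tofrac_eq => /eqP /(congr1 ev); rewrite !rmorphM /= => e.
by apply/eqP; rewrite eqr_div // e.
Qed.

Lemma ratsubstE g v : is_ratsubst phi a g v -> ratsubst phi a g = v.
Proof.
move=> gv; apply: (@xget_unique _ _ _ v) => // w gw.
exact: is_ratsubst_unique gw gv.
Qed.

Lemma ratsubstP g :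
  ratsubst_defined phi a g -> is_ratsubst phi a g (ratsubst phi a g).
Proof. by move=> [v gv]; rewrite (ratsubstE gv). Qed.

Lemma is_ratsubst_poly (p : {mpoly R[n]}) : is_ratsubst phi a p%:F (ev p).
Proof. by exists p, 1; rewrite tofrac1 rmorph1 !divr1 oner_neq0. Qed.

Lemma is_ratsubst0 : is_ratsubst phi a 0 0.
Proof. by have := is_ratsubst_poly 0; rewrite tofrac0 rmorph0. Qed.

Lemma is_ratsubstD g h v w : is_ratsubst phi a g v -> is_ratsubst phi a h w ->
  is_ratsubst phi a (g + h) (v + w).
Proof.
move=> [p [q [q0 -> ->]]] [p' [q' [q'0 -> ->]]].
exists (p * q' + p' * q), (q * q'); split.
- by rewrite rmorphM mulf_neq0.
- by rewrite addf_div ?tofrac_eq0 ?ratsubst_denom_neq0 // !rmorphD !rmorphM.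
- by rewrite addf_div // !rmorphD !rmorphM.
Qed.

Lemma is_ratsubstM g h v w : is_ratsubst phi a g v -> is_ratsubst phi a h w ->
  is_ratsubst phi a (g * h) (v * w).
Proof.
move=> [p [q [q0 -> ->]]] [p' [q' [q'0 -> ->]]].
exists (p * p'), (q * q'); split.
- by rewrite rmorphM mulf_neq0.
- by rewrite mulf_div !rmorphM.
- by rewrite mulf_div !rmorphM.
Qed.

(** A nonzero value means that the numerator does not vanish at a, so it can become the
    denominator. *)
Lemma is_ratsubstV g v : v != 0 -> is_ratsubst phi a g v ->
  is_ratsubst phi a g^-1 v^-1.
Proof.
move=> v0 [p [q [q0 -> vE]]]; exists q, p; rewrite vE !invf_div; split=> //.
by apply: contraNneq v0 => p0; rewrite vE p0 mul0r.
Qed.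

Lemma is_ratsubst_sum (I : finType) (g : I -> ratfun R n) (v : I -> K) :
  (forall i, is_ratsubst phi a (g i) (v i)) ->
  is_ratsubst phi a (\sum_i g i) (\sum_i v i).
Proof.
move=> gv; apply: (big_ind2 (is_ratsubst phi a)) => //.
- exact: is_ratsubst0.
- by move=> *; exact: is_ratsubstD.
Qed.

(** The quotient rule gives the denominator q^2, which vanishes only where q does: differentiation
    creates no new poles. *)
Lemma ratsubst_defined_deriv (j : 'I_n) g :
  ratsubst_defined phi a g -> ratsubst_defined phi a (ratderiv j g).
Proof.
move=> [_ [p [q [q0 -> _]]]]; rewrite ratderiv_frac ?ratsubst_denom_neq0 //.
eexists; eexists; eexists; split; last reflexivity; last reflexivity.
by rewrite rmorphXn expf_neq0.
Qed.

Lemma poly_ratsubst_defined g : is_poly g -> ratsubst_defined phi a g.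
Proof. by move=> [p ->]; eexists; exact: is_ratsubst_poly. Qed.

(** The polynomial case of composition, where no denominator of the outer function has to be
    controlled. *)
Lemma poly_mmap_ratsubst (k : nat) (r : 'cV[ratfun R n]_k) (b : 'cV[K]_k)
    (p : {mpoly R[k]}) :
  (forall i, is_ratsubst phi a (r i 0) (b i 0)) ->
  is_ratsubst phi a (mmap (@ratC R n) (fun i => r i 0) p)
    (mmap phi (fun i => b i 0) p).
Proof.
move=> rb; elim/mpoly_alg_ind: p => [c|i|p q IHp IHq|p q IHp IHq].
- rewrite !mmapC -[X in is_ratsubst _ _ _ X](@mmapC n _ _ (fun i => a i 0)).
  exact: is_ratsubst_poly.
- by rewrite !mmapX !mmap1U.
- by rewrite !rmorphD; exact: is_ratsubstD.
- by rewrite !rmorphM; exact: is_ratsubstM.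
Qed.

(* The denominator q of g cannot vanish identically on r, because q(r) takes at
   a the value q(b), which is nonzero. *)
Lemma is_ratsubst_comp (k : nat) (r : 'cV[ratfun R n]_k) (b : 'cV[K]_k)
    (g : ratfun R k) (v : K) :
    (forall i, is_ratsubst phi a (r i 0) (b i 0)) -> is_ratsubst phi b g v ->
  exists2 w, is_ratsubst (@ratC R n) r g w & is_ratsubst phi a w v.
Proof.
move=> rb [p [q [q0 gE vE]]].
have rp := poly_mmap_ratsubst p rb; have rq := poly_mmap_ratsubst q rb.
exists (mmap (@ratC R n) (fun i => r i 0) p /
  mmap (@ratC R n) (fun i => r i 0) q).
  exists p, q; split=> //.
  apply: contraNneq q0 => e; rewrite e in rq.
  by rewrite (is_ratsubst_unique rq is_ratsubst0).
by rewrite vE; apply: is_ratsubstM => //; exact: is_ratsubstV.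
Qed.

End Ratsubst.

Lemma is_ratsubst_id (R : realType) (n : nat) (g : ratfun R n) :
  is_ratsubst (@ratC R n) (\col_i ratX R i) g g.
Proof.
have e p : mmap (@ratC R n) (fun i => (\col_i ratX R i) i 0) p = p%:F.
  rewrite -mmap_ratX; congr mmap; apply/funext=> i; exact: mxE.
rewrite {1}[g]frac_numden; exists (\n_(repr g)), (\d_(repr g)); rewrite !e.
by rewrite tofrac_eq0 denom_ratioP -frac_numden.
Qed.

(** * Rational functions along curves: limits and the chain rule *)

Section Curves.
Variables (R : realType) (n : nat).
Implicit Types (p q : {mpoly R[n]}) (g : ratfun R n).
Local Notation idR := (fun c : R => c).
Local Notation ev a p := (meval (fun i => a i 0) p).

(** The filter is arbitrary so as to cover both full neighbourhoods and the one-sided limits within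
    [[0, T[]. *)
Lemma meval_cvg (T : Type) (F : set_system T) (FF : Filter F)
    (x : T -> 'cV[R]_n) (b : 'cV[R]_n) p :
  (forall j, x u j 0 @[u --> F] --> b j 0) -> ev (x u) p @[u --> F] --> ev b p.
Proof.
move=> xb; elim/mpoly_alg_ind: p => [c|i|p q IHp IHq|p q IHp IHq].
- rewrite mevalC; under eq_cvg do rewrite mevalC; exact: cvg_cst.
- by rewrite mevalXU; under eq_cvg do rewrite mevalXU; exact: xb.
- by rewrite mevalD; under eq_cvg do rewrite mevalD; apply: cvgD.
- by rewrite mevalM; under eq_cvg do rewrite mevalM; apply: cvgM.
Qed.

Lemma near_meval_neq0 (T : Type) (F : set_system T) (FF : Filter F)
    (x : T -> 'cV[R]_n) (b : 'cV[R]_n) q :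
    (forall j, x u j 0 @[u --> F] --> b j 0) -> ev b q != 0 ->
  \forall u \near F, ev (x u) q != 0.
Proof.
by move=> xb q0; apply: cvgr_neq0 q0; exact: meval_cvg.
Qed.

Lemma ratsubst_frac p q (b : 'cV[R]_n) : ev b q != 0 ->
  is_ratsubst idR b (p%:F / q%:F) (ev b p / ev b q).
Proof. by move=> q0; exists p, q. Qed.

(** The general lemmas ask for a ring morphism; [idfun] carries that structure and is convertible to
    [fun c : R => c]. *)
Lemma ratsubst_fracE p q (b : 'cV[R]_n) : ev b q != 0 ->
  ratsubst idR b (p%:F / q%:F) = ev b p / ev b q.
Proof. by move/(ratsubst_frac p)/(ratsubstE (phi := idfun)). Qed.

(** Being defined is an open condition, since a denominator nonzero at the limit stays nonzero
    nearby. *)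
Lemma near_ratsubst_defined (T : Type) (F : set_system T) (FF : Filter F)
    (x : T -> 'cV[R]_n) (b : 'cV[R]_n) g :
    (forall j, x u j 0 @[u --> F] --> b j 0) -> ratsubst_defined idR b g ->
  \forall u \near F, ratsubst_defined idR (x u) g.
Proof.
move=> xb [_ [p [q [q0 -> _]]]]; have := near_meval_neq0 FF xb q0.
apply: filterS => u.
by move=> h; eexists; exact: ratsubst_frac h.
Qed.

Lemma ratsubst_cvg (T : Type) (F : set_system T) (FF : Filter F)
    (x : T -> 'cV[R]_n) (b : 'cV[R]_n) g :
    (forall j, x u j 0 @[u --> F] --> b j 0) -> ratsubst_defined idR b g ->
  ratsubst idR (x u) g @[u --> F] --> ratsubst idR b g.
Proof.
move=> xb [_ [p [q [q0 -> _]]]]; rewrite ratsubst_fracE //.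
(* The value is p / q only where q does not vanish, hence only eventually along the filter. *)
apply: (@cvg_trans _ (ev (x u) p / ev (x u) q @[u --> F])); last first.
  by apply: cvgM; [|apply: cvgV => //]; exact: meval_cvg.
apply: near_eq_cvg; have := near_meval_neq0 FF xb q0.
apply: filterS => u.
by move=> h; rewrite ratsubst_fracE.
Qed.

Variables (x : R -> 'cV[R]_n) (t : R) (d : 'I_n -> R).
Hypothesis x_deriv : forall j, is_derive t 1 (fun u => x u j 0) (d j).

(** The chain rule, by induction: formal partial derivatives and derivatives in t obey the same sum
    and product rules. *)
Lemma meval_is_derive p : is_derive t 1 (fun u => ev (x u) p)
  (\sum_j ev (x t) p^`M(j) * d j).
Proof.
elim/mpoly_alg_ind: p => [c|i|p q IHp IHq|p q IHp IHq].
- rewrite (eq_fun (fun u => mevalC _ _)).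
  rewrite big1 => [|j _]; first exact: is_derive_cst.
  by rewrite mderivC meval0 mul0r.
- rewrite (eq_fun (fun u => mevalXU (fun k => x u k 0) i)).
  rewrite (bigD1 i) //= big1 => [|j ji].
    have -> : mderiv i 'X_i = 1 :> {mpoly R[n]}.
      rewrite mderivX mnmE eqxx scale1r -mpolyX0; congr 'X_[_].
      by apply/mnmP => k; rewrite mnmBE subnn mnm0E.
    by rewrite meval1 mul1r addr0.
  by rewrite mderivX mnmE eq_sym (negbTE ji) scale0r meval0 mul0r.
- rewrite (eq_fun (fun u => mevalD (fun k => x u k 0) p q)).
  apply: (is_derive_eq (is_deriveD IHp IHq)).
  by rewrite -big_split; apply: eq_bigr => j _; rewrite mderivD mevalD mulrDl.
- rewrite (eq_fun (fun u => mevalM (fun k => x u k 0) p q)).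
  apply: (is_derive_eq (is_deriveM IHp IHq)).
  rewrite !scaler_sumr -big_split; apply: eq_bigr => j _ /=.
  rewrite mderivM mevalD !mevalM /GRing.scale /=; ring.
Qed.

Lemma curve_cvg j : x u j 0 @[u --> t] --> x t j 0.
Proof.
have [/derivable1_diffP/differentiable_continuous + _] := x_deriv j.
exact.
Qed.

Lemma ratsubst_is_derive g : ratsubst_defined idR (x t) g ->
  is_derive t 1 (fun u => ratsubst idR (x u) g)
    (\sum_j ratsubst idR (x t) (ratderiv j g) * d j).
Proof.
move=> [_ [p [q [q0 -> _]]]]; have {}q0 : ev (x t) q != 0 := q0.
have q0' := ratsubst_denom_neq0 (phi := idfun) q0.
(* By continuity of the curve, the function agrees near t with a quotient of polynomials, to which
   the quotient rule applies. *)
apply: (@near_eq_is_derive _ _ _ (fun u => ev (x u) p / ev (x u) q)).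
  have := near_meval_neq0 (nbhs_filter t) curve_cvg q0; apply: filterS => u.
  by move=> h; rewrite ratsubst_fracE.
have dq := is_deriveV (f := fun u => ev (x u) q) q0 (meval_is_derive q).
apply: (is_derive_eq (is_deriveM (meval_is_derive p) dq)).
rewrite !scaler_sumr -big_split; apply: eq_bigr => j _ /=.
rewrite ratderiv_frac // ratsubst_fracE ?rmorphXn ?expf_neq0 //=.
rewrite mevalB !mevalM /GRing.scale /=.
by field; exact: q0.

Qed.

End Curves.

(** * Tuples of rational functions at real points *)

Section Rateval.
Variables (R : realType) (m n : nat).
Implicit Types (g : 'cV[ratfun R n]_m) (a : 'cV[R]_n).
Local Notation idR := (fun c : R => c).

Lemma ratevalE g a i v : is_ratsubst idR a (g i 0) v -> rateval g a i 0 = v.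
Proof. by move=> gv; rewrite mxE; exact: (ratsubstE (phi := idfun)) gv. Qed.

Lemma ratevalP g a : defined_at g a ->
  forall i, is_ratsubst idR a (g i 0) (rateval g a i 0).
Proof. by move=> ga i; rewrite mxE; exact: (ratsubstP (phi := idfun)). Qed.

Lemma poly_defined_at g a : is_polymap g -> defined_at g a.
Proof. by move=> gp i; exact: (poly_ratsubst_defined idfun). Qed.

Lemma ratjac_mulE g (f : 'cV[ratfun R n]_n) i :
  (ratjac g *m f) i 0 = \sum_j ratderiv j (g i 0) * f j 0.
Proof. by rewrite mxE; apply: eq_bigr => j _; rewrite mxE. Qed.

Lemma ratjac_mul_defined g (f : 'cV[ratfun R n]_n) a :
  defined_at g a -> defined_at f a -> defined_at (ratjac g *m f) a.
Proof.
move=> ga fa i; rewrite ratjac_mulE; eexists.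
apply: (is_ratsubst_sum (phi := idfun)) => j.
apply: (is_ratsubstM (phi := idfun)); apply: (ratsubstP (phi := idfun)) => //.
exact: (ratsubst_defined_deriv (phi := idfun)).
Qed.

Lemma ratjac_mul_poly g (f : 'cV[ratfun R n]_n) :
  is_polymap g -> is_polymap f -> is_polymap (ratjac g *m f).
Proof.
move=> gp fp i; rewrite ratjac_mulE; apply: is_poly_sum => j.
by apply: is_polyM => //; exact: is_poly_deriv.
Qed.

(** Brings the identity F(g) = h of rational functions down to the point a: the composite takes at a
    the value of F at g(a), and it is h by uniqueness. *)
Lemma is_ratsubst_rateval g a (F : ratfun R m) (h : ratfun R n) :
    defined_at g a -> is_ratsubst (@ratC R n) g F h ->
    ratsubst_defined idR (rateval g a) F ->
  is_ratsubst idR (rateval g a) F (ratsubst idR a h).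
Proof.
move=> ga Fh [v Fv].
have [w Fw wv] := is_ratsubst_comp (phi := idfun) (ratevalP ga) Fv.
rewrite (is_ratsubst_unique Fh Fw).
by have -> : ratsubst idR a w = v := ratsubstE (phi := idfun) wv.
Qed.

End Rateval.

(** * Composition with a rational inverse *)

Section Inverse.
Variables (R : realType) (n k : nat).
Variables (s : 'cV[ratfun R n]_k) (sinv : 'cV[ratfun R k]_n).
Hypothesis sinvP : rat_inverse s sinv.
Local Notation idR := (fun c : R => c).

Lemma rat_inverse_comp (g : ratfun R n) :
  exists2 w, is_ratsubst (@ratC R k) sinv g w & is_ratsubst (@ratC R n) s w g.
Proof.
by apply: is_ratsubst_comp (is_ratsubst_id g) => i; rewrite mxE; exact: sinvP.
Qed.

Lemma rat_inverse_composable m (g : 'cV[ratfun R n]_m) : ratcomposable g sinv.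
Proof. by move=> i; have [w gw _] := rat_inverse_comp (g i 0); exists w. Qed.

Lemma ratcomp_inverseK m (g : 'cV[ratfun R n]_m) i :
  is_ratsubst (@ratC R n) s (ratcomp g sinv i 0) (g i 0).
Proof.
have [w gw wg] := rat_inverse_comp (g i 0).
by rewrite mxE (ratsubstE gw).
Qed.

Lemma rateval_inverseK a : defined_at s a -> defined_at sinv (rateval s a) ->
  rateval sinv (rateval s a) = a.
Proof.
move=> sa da; apply/colP=> i; apply: ratevalE.
(* The coordinate of a is read as the value of the rational function x_i, so that the identity
   s^-1(s) = x can be specialized at a. *)
have <- : ratsubst idR a (ratX R i) = a i 0.
  apply: (ratsubstE (phi := idfun)).
  by have := is_ratsubst_poly idfun a 'X_i; rewrite mmapX mmap1U.
exact: is_ratsubst_rateval.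
Qed.

(** As s^-1 sends s(a) back to a, where g is defined, the composite of g with s^-1 is defined at
    s(a). *)
Lemma ratcomp_inverse_defined m (g : 'cV[ratfun R n]_m) a :
    defined_at s a -> defined_at sinv (rateval s a) -> defined_at g a ->
  defined_at (ratcomp g sinv) (rateval s a).
Proof.
move=> sa da ga i; have [v gv] := ga i; rewrite -(rateval_inverseK sa da) in gv.
have [w gw wv] := is_ratsubst_comp (phi := idfun) (ratevalP da) gv.
by exists v; rewrite mxE (ratsubstE gw).
Qed.

Lemma ratcomp_poly m (g : 'cV[ratfun R n]_m) :
  is_polymap sinv -> is_polymap g -> is_polymap (ratcomp g sinv).
Proof.
move=> sp gp i; have [p gE] := gp i.
rewrite mxE gE (ratsubstE (is_ratsubst_poly _ _ p)).
exact: is_poly_mmap.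
Qed.

End Inverse.

(** * The functions s_k and the state-space transformation *)

Section System.
Variables (R : realType) (n my : nat) (S : system R n my).
Local Notation idR := (fun c : R => c).

Lemma sfun_defined k a : system_defined_at S a -> defined_at (sfun S k) a.
Proof.
by move=> [fa ha]; elim: k => [|k IHk] //=; exact: ratjac_mul_defined.
Qed.

Lemma sfun_poly k : polynomial_system S -> is_polymap (sfun S k).
Proof. by move=> [fp hp]; elim: k => [|k IHk] //=; exact: ratjac_mul_poly. Qed.

Lemma sigmaE k (j : 'I_my) : sigma S (k * my + j) = sfun S k j 0.
Proof.
rewrite /sigma modnMDl modn_small // divnMDl ?divn_small ?addn0; last 2 first.
- exact: ltn_ord.
- exact: leq_ltn_trans (leq0n j) (ltn_ord j).
case: insubP => [u _ uj|]; last by rewrite ltn_ord.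
by congr (sfun S k _ _); exact: val_inj.
Qed.

Lemma sigma_sfun i : (0 < my)%N -> exists k j, sigma S i = sfun S k j 0.
Proof.
move=> my0; exists (i %/ my)%N, (Ordinal (ltn_pmod i my0)).
by rewrite -sigmaE /= -divn_eq.
Qed.

Lemma state_map_sfun mo (i : 'I_(mo * my)) :
  exists k j, state_map S mo i 0 = sfun S k j 0.
Proof.
rewrite mxE; apply: sigma_sfun.
(* The mere existence of an index below [mo * my] gives 0 < my. *)
by have := leq_ltn_trans (leq0n i) (ltn_ord i); rewrite muln_gt0 => /andP[].
Qed.

Lemma state_map_defined mo a :
  system_defined_at S a -> defined_at (state_map S mo) a.
Proof.
by move=> Sa i; have [k [j ->]] := state_map_sfun i; exact: sfun_defined.
Qed.

Lemma state_map_poly mo : polynomial_system S -> is_polymap (state_map S mo).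
Proof.
by move=> Sp i; have [k [j ->]] := state_map_sfun i; exact: sfun_poly.
Qed.

Lemma rateval_state_map mo (i : 'I_(mo * my)) k (j : 'I_my) a :
    i = (k * my + j)%N :> nat ->
  rateval (state_map S mo) a i 0 = rateval (sfun S k) a j 0.
Proof. by move=> ikj; rewrite !mxE ikj sigmaE. Qed.

(** * States and outputs along a solution *)

Variables (T : R) (x : R -> 'cV[R]_n).
Hypothesis xS : solution S T x.

Lemma solution_defined t : t \in `[0, T[ -> system_defined_at S (x t).
Proof. by have [_ _ + _] := xS; apply. Qed.

Lemma solution_definedo t : t \in `]0, T[ -> system_defined_at S (x t).
Proof.
by move=> tT; apply: solution_defined; apply: subset_itv_oo_co tT.
Qed.

(** The chain rule along a solution: differentiating in t amounts to taking the Lie derivative along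
    f. *)
Lemma solution_is_derive m (g : 'cV[ratfun R n]_m) i t :
    t \in `]0, T[ -> defined_at g (x t) ->
  is_derive t 1 (fun u => rateval g (x u) i 0)
    (rateval (ratjac g *m sys_f S) (x t) i 0).
Proof.
move=> tT gt; have [fa _] := solution_definedo tT.
rewrite (eq_fun (fun u => mxE _ _ i 0)).
have xd : ode_at S x t by have [_ _ _] := xS; apply.
apply: (is_derive_eq (ratsubst_is_derive xd (gt i))).
symmetry; apply: ratevalE; rewrite ratjac_mulE.
apply: (is_ratsubst_sum (phi := idfun)) => j.
apply: (is_ratsubstM (phi := idfun)); last exact: ratevalP.
apply: (ratsubstP (phi := idfun)).
exact: (ratsubst_defined_deriv (phi := idfun)).
Qed.

Lemma derive1n_output k (j : 'I_my) t : t \in `]0, T[ ->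
  derive1n k (fun u => output S x u j 0) t = rateval (sfun S k) (x t) j 0.
Proof.
elim: k t => [|k IHk] t tT //.
rewrite derive1nS derive1E.
have [_ <-] := solution_is_derive j tT (sfun_defined k (solution_definedo tT)).
(* The induction hypothesis holds on the whole open interval, hence near t, which is enough to
   differentiate it. *)
apply: near_eq_derive; have := near_in_itvoo tT.
by apply: filterS => u; exact: IHk.
Qed.

Lemma derivable_derive1n_output k (j : 'I_my) t : t \in `]0, T[ ->
  derivable (derive1n k (fun u => output S x u j 0)) t 1.
Proof.
move=> tT.
have [+ _] := solution_is_derive j tT (sfun_defined k (solution_definedo tT)).
apply: near_eq_derivable; have := near_in_itvoo tT.
by apply: filterS => u uT; rewrite derive1n_output.
Qed.

Lemma state_map_jet mo t : t \in `]0, T[ ->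
  is_jet (output S x) t (rateval (state_map S mo) (x t)).
Proof.
move=> tT i k j ikj; split=> [|l _]; last exact: derivable_derive1n_output.
by rewrite derive1n_output // (rateval_state_map _ ikj).
Qed.

Lemma solution_cvg t : t \in `[0, T[ ->
  forall j, x u j 0 @[u --> within `[0, T[ (nbhs t)] --> x t j 0.
Proof.
move=> tT j; have [_ /(_ j) xc _ _] := xS.
by move/subspace_continuousP : xc; apply.
Qed.

Lemma rateval_continuous m (g : 'cV[ratfun R n]_m) i :
    (forall t, t \in `[0, T[ -> defined_at g (x t)) ->
  {within `[0, T[, continuous (fun u => rateval g (x u) i 0)}.
Proof.
move=> gd; apply/subspace_continuousP => t tT.
rewrite (eq_fun (fun u => mxE _ _ i 0)).
exact: ratsubst_cvg (solution_cvg tT) (gd t tT i).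
Qed.

(** Serves to shrink the interval to one on which f_or stays defined. *)
Lemma solution_le T' : T' <= T -> solution S T' x.
Proof.
move=> T'T; have [x0 xc xd xode] := xS.
have sub t : t \in `[0, T'[ -> t \in `[0, T[.
  by rewrite !in_itv /= => /andP[-> /lt_le_trans]; apply.
split=> // [i|t /sub|t]; [|exact: xd|].
  by apply: continuous_subspaceW (xc i) => t; exact: sub.
rewrite in_itv /= => /andP[t0 tT']; apply: xode.
by rewrite in_itv /= t0 (lt_le_trans tT').
Qed.

End System.

(** * The output-based realization *)

Section Realization.
Variables (R : realType) (n my mo : nat) (S : system R n my).
Variable sinv : 'cV[ratfun R (mo * my)]_n.
Hypothesis mo_gt0 : (0 < mo)%N.
Local Notation s := (state_map S mo).
Local Notation S' := (sys_or S sinv).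
Local Notation idR := (fun c : R => c).

Lemma linmap_CoE (i : 'I_my) (k : 'I_(mo * my)) : k = i :> nat ->
  linmap (Co R mo my) i 0 = ratX R k.
Proof.
move=> ki; rewrite mxE (bigD1 k) //= big1 ?addr0 => [|l lk].
  by rewrite !mxE ki eqxx rmorph1 mul1r.
rewrite !mxE (_ : (i == l :> nat) = false) ?rmorph0 ?mul0r //.
by rewrite -ki eq_sym; apply/negbTE.
Qed.

Lemma output_index_proof (i : 'I_my) : (i < mo * my)%N.
Proof. by rewrite (leq_trans (ltn_ord i)) // leq_pmull. Qed.

Lemma linmap_Co_poly : is_polymap (linmap (Co R mo my)).
Proof.
move=> i; rewrite (linmap_CoE (k := Ordinal (output_index_proof i))) //.
by eexists.
Qed.

(** C_o selects the first block of s, which is s_1 = h. *)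
Lemma output_sys_or (x : R -> 'cV[R]_n) t :
  output S' (fun u => rateval s (x u)) t = output S x t.
Proof.
apply/colP=> i; apply: ratevalE.
rewrite (linmap_CoE (k := Ordinal (output_index_proof i))) //.
have -> : output S x t i 0 = rateval s (x t) (Ordinal (output_index_proof i)) 0.
  by rewrite (@rateval_state_map _ _ _ _ _ _ 0%N i).
have := is_ratsubst_poly idfun (rateval s (x t))
  'X_(Ordinal (output_index_proof i)).
by rewrite mmapX mmap1U.
Qed.

Hypothesis sinvP : rat_inverse s sinv.

Lemma sys_or_realizes_where_defined T (x : R -> 'cV[R]_n) :
  solution S T x -> realizes_where_defined S S' s T x.
Proof.
move=> xS; have [x0 _ _ _] := xS; split=> [|i|t tT [fd _] i|t tT|t tT].
- by rewrite x0.
- apply: (rateval_continuous xS) => t tT.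
  exact: state_map_defined (solution_defined xS tT).
- have sd := state_map_defined (mo := mo) (solution_definedo xS tT).
  apply: (is_derive_eq (solution_is_derive xS i tT sd)).
  (* The derivative of s(x(t)) is the Lie derivative of s at x(t); f_or takes this value at s(x(t))
     because f_or(s) is that Lie derivative. *)
  symmetry; rewrite [RHS]mxE; apply: ratevalE; apply: is_ratsubst_rateval => //.
  exact: ratcomp_inverseK.
- exact: output_sys_or.
- exact: (state_map_jet xS).
Qed.

Lemma sys_or_realizes_on T (x : R -> 'cV[R]_n) : solution S T x ->
    (forall t, t \in `[0, T[ -> system_defined_at S' (rateval s (x t))) ->
  realizes_on S S' s T x.
Proof.
move=> /sys_or_realizes_where_defined[x0 xc xode xo xj] S'd; split=> //.
split=> // t tT; apply: xode => //.
by apply: S'd; apply: subset_itv_oo_co tT.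
Qed.

Lemma sys_or_defined a : system_defined_at S a ->
  defined_at sinv (rateval s a) -> system_defined_at S' (rateval s a).
Proof.
move=> Sa da; split; last exact: poly_defined_at linmap_Co_poly.
apply: ratcomp_inverse_defined => //; first exact: state_map_defined.
by apply: ratjac_mul_defined (proj1 Sa); exact: state_map_defined.
Qed.

(** The state is continuous at 0 from the right, so f_or, defined at the initial state, remains
    defined for a short time. *)
Lemma sys_or_realizes_locally T (x : R -> 'cV[R]_n) :
    0 < T -> solution S T x -> system_defined_at S' (rateval s (x 0)) ->
  exists T' : R, [/\ 0 < T', T' <= T & realizes_on S S' s T' x].
Proof.
move=> T0 xS [fd _].
have T00 : 0 \in `[0, T[ by rewrite in_itv /= lexx.
have xhc j : rateval s (x u) j 0 @[u --> within `[0, T[ (nbhs 0)]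
    --> rateval s (x 0) j 0.
  have := @rateval_continuous _ _ _ _ _ _ xS _ s j
    (fun t tT => state_map_defined (mo := mo) (solution_defined xS tT)).
  by move/subspace_continuousP; apply.
have : \forall u \near within `[0, T[ (nbhs (0 : R)),
    defined_at (sys_f S') (rateval s (x u)).
  apply: filter_forall => i.
  exact: near_ratsubst_defined xhc (fd i).
move=> /nbhs_ballP[e /= e0 ed].
(* e is the radius around 0 on which f_or is defined along the state; the minimum with T keeps
   within the given solution. *)
exists (Num.min e T); split; rewrite ?lt_min ?e0 ?ge_min ?lexx ?orbT //.
have leT : Num.min e T <= T by rewrite ge_min lexx orbT.
apply: sys_or_realizes_on; first exact: solution_le xS _ leT.
move=> t; rewrite in_itv /= lt_min => /and3P[t0 te tT].
split; last exact: poly_defined_at linmap_Co_poly.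
apply: ed; last by rewrite /= in_itv /= t0.
by rewrite /ball /= sub0r normrN ger0_norm.
Qed.

Lemma sys_or_polynomial : polynomial_system S -> is_polymap sinv ->
  polynomial_system S'.
Proof.
move=> Sp sp; split; last exact: linmap_Co_poly.
apply: ratcomp_poly => //; apply: ratjac_mul_poly (proj1 Sp).
exact: state_map_poly.
Qed.

End Realization.

(** * Observability indices and existence of inverses *)

Section Observability.
Variables (R : realType) (n my : nat) (S : system R n my).
Hypothesis my_gt0 : (0 < my)%N.

Lemma Aobs_sub m m' : (m <= m')%N -> Aobs S m `<=` Aobs S m'.
Proof.
move=> mm' _ [P ->]; elim/mpoly_alg_ind: P => [c|i|p q IHp IHq|p q IHp IHq].
- by exists c%:MP; rewrite !mmapC.
- by exists 'X_(widen_ord mm' i); rewrite !mmapX !mmap1U.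
- have [[p' pE] [q' qE]] := (IHp, IHq).
  by exists (p' + q'); rewrite !rmorphD /= pE qE.
- have [[p' pE] [q' qE]] := (IHp, IHq).
  by exists (p' * q'); rewrite !rmorphM /= pE qE.
Qed.

Lemma Aobs_poly m : polynomial_system S -> Aobs S m `<=` @is_poly R n.
Proof.
move=> Sp _ [P ->]; apply: is_poly_mmap => i.
by have [k [j ->]] := sigma_sfun S i my_gt0; exact: sfun_poly.
Qed.

Lemma rat_generated_le m m' :
  (m <= m')%N -> rat_generated S m -> rat_generated S m'.
Proof.
move=> mm' Sm; apply/seteqP; split=> // g _.
have [a [b [Sa Sb b0 ->]]] : Qobs S m g by rewrite Sm.
by exists a, b; split=> //; exact: Aobs_sub mm' _ _.
Qed.

(** Adding generators must not leave R[x]; the polynomial system guarantees this, as all its s_k are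
    polynomial. *)
Lemma poly_generated_le m m' : polynomial_system S ->
  (m <= m')%N -> poly_generated S m -> poly_generated S m'.
Proof.
move=> Sp mm' Sm; apply/seteqP; split=> [|g gp]; first exact: Aobs_poly.
by apply: (Aobs_sub mm'); rewrite Sm.
Qed.

Lemma least_positive_exists (P : nat -> Prop) m :
  (0 < m)%N -> P m -> exists mo, least_positive P mo.
Proof.
move=> m0 Pm; have : exists k, (0 < k)%N && `[< P k >].
  (* P is made boolean classically so that [ex_minnP] gives the minimum. *)
  by exists m; rewrite m0; apply/asboolP.
case/ex_minnP => mo /andP[mo0 /asboolP Pmo] mo_min.
exists mo; split=> // k k0 Pk; apply: mo_min.
by rewrite k0; apply/asboolP.
Qed.

Lemma rat_obs_index_exists : rat_observable S -> exists mo, rat_obs_index S mo.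
Proof.
move=> [m [m0 Sm]]; apply: (least_positive_exists m0).
(* The first m scalar components lie in the first m blocks, so m also bounds the number of
   blocks. *)
by apply: rat_generated_le Sm; rewrite leq_pmulr.
Qed.

Lemma poly_obs_index_exists : polynomial_system S -> poly_observable S ->
  exists mo, poly_obs_index S mo.
Proof.
move=> Sp [m [m0 Sm]]; apply: (least_positive_exists m0).
by apply: poly_generated_le Sm => //; rewrite leq_pmulr.
Qed.

Lemma mmap_state_map mo (P : {mpoly R[mo * my]}) :
  mmap (@ratC R n) (fun i => state_map S mo i 0) P =
  mmap (@ratC R n) (fun i : 'I_(mo * my) => sigma S i) P.
Proof. by congr mmap; apply/funext => i; rewrite mxE. Qed.

(** Generation writes x_i as P(s) / Q(s) with Q(s) nonzero; P / Q is then the component i of the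
    inverse. *)
Lemma rat_inverse_exists mo : rat_generated S (mo * my) ->
  exists sinv, rat_inverse (state_map S mo) sinv.
Proof.
move=> Sm; have /choice[f fP] : forall i : 'I_n, exists r : ratfun R (mo * my),
    is_ratsubst (@ratC R n) (state_map S mo) r (ratX R i).
  move=> i; have [a [b [[P ->] [Q ->] Q0 ->]]] : Qobs S (mo * my) (ratX R i).
    by rewrite Sm.
  by exists (P%:F / Q%:F), P, Q; rewrite !mmap_state_map.
by exists (\col_i f i) => i; rewrite mxE.
Qed.

Lemma poly_inverse_exists mo : poly_generated S (mo * my) ->
  exists sinv, poly_inverse (state_map S mo) sinv.
Proof.
move=> Sm; have /choice[f fP] : forall i : 'I_n, exists P : {mpoly R[mo * my]},
    ratX R i = mmap (@ratC R n) (fun i => state_map S mo i 0) P.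
  move=> i; have [P XP] : Aobs S (mo * my) (ratX R i) by rewrite Sm; eexists.
  by exists P; rewrite mmap_state_map.
exists (\col_i (f i)%:F); split=> i; rewrite mxE; first by eexists.
by rewrite fP; exact: is_ratsubst_poly.
Qed.

End Observability.

(** A rational inverse is an identity of rational functions and may have a pole at s(x_0); this
    explains the condition on [sinv] before the local realization. A polynomial inverse has no
    poles, and the realization holds on all of [[0, T[]. *)
Theorem theoremV3 (R : realType) (n my : nat) (Sigma : system R n my)
    (hmy : (0 < my)%N) :
  (rational_system Sigma -> rat_observable Sigma ->
    exists mo : nat, let s := state_map Sigma mo in
    [/\ rat_obs_index Sigma mo,
        defined_at s (sys_x0 Sigma),
        exists sinv, rat_inverse s sinv
      & forall sinv, rat_inverse s sinv ->
        [/\ ratcomposable (ratjac s *m sys_f Sigma) sinv,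
            forall (T : R) (x : R -> 'cV[R]_n), 0 < T -> solution Sigma T x ->
              realizes_where_defined Sigma (sys_or Sigma sinv) s T x
          & defined_at sinv (rateval s (sys_x0 Sigma)) ->
              rational_system (sys_or Sigma sinv) /\
              forall (T : R) (x : R -> 'cV[R]_n), 0 < T ->
                solution Sigma T x ->
                exists T' : R, [/\ 0 < T', T' <= T
                  & realizes_on Sigma (sys_or Sigma sinv) s T' x]]])
  /\
  (polynomial_system Sigma -> poly_observable Sigma ->
    exists mo : nat, let s := state_map Sigma mo in
    [/\ poly_obs_index Sigma mo,
        exists sinv, poly_inverse s sinv
      & forall sinv, poly_inverse s sinv ->
        [/\ ratcomposable (ratjac s *m sys_f Sigma) sinv,
            polynomial_system (sys_or Sigma sinv)
          & forall (T : R) (x : R -> 'cV[R]_n), 0 < T -> solution Sigma T x ->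
              realizes_on Sigma (sys_or Sigma sinv) s T x]]).
Proof.
split=> [Srat /(rat_obs_index_exists hmy)|
         Spol /(poly_obs_index_exists hmy Spol)].
  move=> [mo Smo]; exists mo => s; have [mo0 Sgen _] := Smo.
  split=> // [||sinv sinvP]; first exact: state_map_defined.
    exact: rat_inverse_exists.
  split=> [|T x _ xS|sd]; first exact: rat_inverse_composable sinvP _ _.
    exact: sys_or_realizes_where_defined.
  have S'd := sys_or_defined mo0 sinvP Srat sd; split=> // T x T0 xS.
  apply: sys_or_realizes_locally => //.
  by have [-> _ _ _] := xS.
move=> [mo Smo]; exists mo => s; have [mo0 Sgen _] := Smo.
split=> // [|sinv [sinvp sinvP]]; first exact: poly_inverse_exists.
have S'p := sys_or_polynomial mo0 Spol sinvp.
split=> // [|T x _ xS]; first exact: rat_inverse_composable sinvP _ _.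
(* A polynomial right-hand side is defined at every state. *)
apply: sys_or_realizes_on => // t _.
by split; apply: poly_defined_at; case: S'p.
Qed.
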